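(* Let $N \geq 1$ and let $A \in \mathbb{C}^{N \times N}$ be a Hermitian matrix. The following are equivalent. (1) The matrix $A$ is $3$-PMP and all its entries have modulus $0$ or $1$. (2) There exist a diagonal matrix $D$, whose diagonal entries lie in $S^1 = \{ z \in \mathbb{C} : |z| = 1 \}$, and a permutation matrix $Q$, such that $(QD)^{-1} A (QD)$ is a block-diagonal matrix with each diagonal block a square matrix of either all ones or all zeros. (3) The matrix $A$ is positive semidefinite and all its entries have modulus $0$ or $1$.
   Context: A Hermitian matrix in $\mathbb{C}^{N \times N}$ is called $3$-PMP (principal minor positive) if all its principal minors of size at most $3$ are non-negative (for $N < 3$ this means all its principal minors). *)

(* Defs.v *)
From mathcomp Require Export all_boot all_order all_algebra.
From mathcomp Require Export reals complex.

Set Implicit Arguments.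
Unset Strict Implicit.
Unset Printing Implicit Defensive.

Import Order.TTheory GRing.Theory Num.Theory.
Local Open Scope ring_scope.
Local Open Scope sesquilinear_scope.
Local Open Scope complex_scope.

(* In the partial order of R[i], 0 <= z means that z is real and nonnegative. *)

Definition principal_submx (R : realType) (N : nat) (S : {set 'I_N})
    (A : 'M[R[i]]_N) : 'M[R[i]]_#|S| :=
  mxsub (@enum_val _ (mem S)) (@enum_val _ (mem S)) A.

Definition principal_minor (R : realType) (N : nat) (S : {set 'I_N})
    (A : 'M[R[i]]_N) : R[i] :=
  \det (principal_submx S A).

(* The case S = set0 is harmless: the empty minor is 1. *)
Definition kPMP (R : realType) (k N : nat) (A : 'M[R[i]]_N) : Prop :=
  A \is hermsymmx /\
  forall S : {set 'I_N}, (#|S| <= k)%N -> 0 <= principal_minor S A.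

Definition positive_semidefinite (R : realType) (N : nat) (A : 'M[R[i]]_N) :
    Prop :=
  A \is hermsymmx /\
  forall x : 'cV[R[i]]_N, 0 <= (x ^t* *m A *m x) 0 0.

Definition entries_modulus01 (R : realType) (N : nat) (A : 'M[R[i]]_N) : Prop :=
  forall i j : 'I_N, `|A i j| = 0 \/ `|A i j| = 1.

Definition unimodular_diag (R : realType) (N : nat) (D : 'M[R[i]]_N) : Prop :=
  is_diag_mx D /\ forall i : 'I_N, `|D i i| = 1.

(* The cast only transports along the equation between the sum of the block
   sizes and N. *)
Definition block_diag_ones_zeros (R : realType) (N : nat) (B : 'M[R[i]]_N) :
    Prop :=
  exists (m : nat) (p : 'I_m -> nat) (eN : (\sum_(i < m) p i)%N = N)
         (blk : forall i : 'I_m, 'M[R[i]]_(p i)),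
    [/\ forall i, (0 < p i)%N,
        forall i, blk i = const_mx 1 \/ blk i = const_mx 0
      & B = castmx (eN, eN) (\mxdiag_(i < m) blk i)].

(* Main.v *)
Require Import Defs.
From mathcomp Require Import fingroup perm ring.

(** All three conditions say that A has the form
      A i j = u i * (u j)^* if i and j carry the same label and that label is
      switched on, and 0 otherwise,
    with u unimodular; this form is called [phased_blocks] below.

    From 3-PMP to this form. The minors of size 1 make the diagonal entries 0
    or 1, and those of size 2 force A i i = A j j = 1 whenever A i j is nonzero.
    For three indices whose diagonal entries are 1 and with A i j, A j k
    unimodular, the 3 x 3 minor equals - |A i k - A i j * A j k| ^ 2, so its
    nonnegativity is the cocycle identity A i k = A i j * A j k
    ([kPMP_entry_mul]). Hence being linked by a nonzero entry is transitive,
    and on a class with representative r the cocycle is a coboundary: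
    A i j = A i r * (A j r)^* ([kPMP_phased_blocks]).

    From this form to a block diagonal matrix. Listing the indices label by
    label makes every class an interval ([block_diag_of_labels]), and the phases
    u are absorbed in the diagonal matrix D. Reading the conjugation backwards
    gives the form back from condition (2).

    From this form to positivity. A is the sum, over the labels switched on, of
    the rank one matrices v v^*, where v is u restricted to the label
    ([phased_blocks_psd]).

    From positivity to minors. A principal submatrix of a positive semidefinite
    matrix is positive semidefinite, and by the spectral theorem its determinant
    is a product of nonnegative eigenvalues ([psd_kPMP], [det_psd_ge0]). *)

Set Implicit Arguments.
Unset Strict Implicit.
Unset Printing Implicit Defensive.

Import Order.TTheory GRing.Theory Num.Theory.
Local Open Scope ring_scope.
Local Open Scope sesquilinear_scope.

(** * Principal minors along injective index maps *)

(** Two enumerations of the same index set differ by a permutation, whose sign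
    enters once through the rows and once through the columns. *)
Lemma det_mxsub_codom (K : comPzRingType) (n N : nat) (f g : 'I_n -> 'I_N)
    (A : 'M[K]_N) :
  injective f -> injective g -> codom f =i codom g ->
  \det (mxsub f f A) = \det (mxsub g g A).
Proof.
move=> f_inj g_inj fg.
have f_in i : f i \in codom g by rewrite -fg codom_f.
pose s i := iinv (f_in i).
have gs i : g (s i) = f i by rewrite f_iinv.
have s_inj : injective s by move=> i j eq_s; apply: f_inj; rewrite -!gs eq_s.
have -> : mxsub f f A = row_perm (perm s_inj) (col_perm (perm s_inj) (mxsub g g A)).
  by apply/matrixP=> i j; rewrite !mxE !permE !gs.
rewrite row_permE col_permE !det_mulmx !det_perm odd_permV mulrC -mulrA.
by rewrite -signr_addb addbb mulr1.
Qed.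

Lemma det_mxsub_cast (K : comPzRingType) (m n N : nat) (e : m = n)
    (f : 'I_n -> 'I_N) (A : 'M[K]_N) :
  \det (mxsub (f \o cast_ord e) (f \o cast_ord e) A) = \det (mxsub f f A).
Proof.
case: _ / e f => f; congr (\det _).
by apply/matrixP=> i j; rewrite !mxE /= !cast_ord_id.
Qed.

(** Minors indexed by subsets are read in the order of [enum_val]; this gives
    access to them through any convenient listing of the indices. *)
Lemma kPMP_det_mxsub (R : realType) (k n N : nat) (A : 'M[R[i]%C]_N)
    (f : 'I_n -> 'I_N) :
  kPMP k A -> injective f -> (n <= k)%N -> 0 <= \det (mxsub f f A).
Proof.
move=> [_ minorA] f_inj le_nk; pose S := [set x in codom f].
have cardS : #|S| = n by rewrite cardsE card_codom // card_ord.
have := minorA S; rewrite cardS => /(_ le_nk); congr (0 <= _).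
rewrite -(det_mxsub_cast cardS f); apply: det_mxsub_codom.
- exact: enum_val_inj.
- exact: inj_comp f_inj (@cast_ord_inj _ _ _).
move=> x; apply/codomP/codomP=> [[a ->] | [a ->]].
  have : enum_val a \in S by apply: enum_valP.
  rewrite inE => /codomP[b ->]; exists (cast_ord (esym cardS) b).
  by rewrite /= cast_ordKV.
have fS : f (cast_ord cardS a) \in S by rewrite inE codom_f.
by exists (enum_rank_in fS (f (cast_ord cardS a))); rewrite enum_rankK_in.
Qed.

Section SmallDeterminants.
Variables (K : comPzRingType) (N : nat) (A : 'M[K]_N).

Lemma det_mxsub1 (i : 'I_N) (t := [tuple i]) :
  \det (mxsub (tnth t) (tnth t) A) = A i i.
Proof. by rewrite det_mx11 !mxE !(tnth_nth i). Qed.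

Lemma det_mxsub2 (i j : 'I_N) (t := [tuple i; j]) :
  \det (mxsub (tnth t) (tnth t) A) = A i i * A j j - A i j * A j i.
Proof.
rewrite (expand_det_row _ ord0) !big_ord_recl big_ord0 /cofactor !det_mx11.
rewrite !mxE !(tnth_nth i) /= /bump /=; ring.
Qed.

Lemma det_mxsub3 (i j k : 'I_N) (t := [tuple i; j; k]) :
  \det (mxsub (tnth t) (tnth t) A) =
    A i i * (A j j * A k k - A j k * A k j)
    - A i j * (A j i * A k k - A j k * A k i)
    + A i k * (A j i * A k j - A j j * A k i).
Proof.
rewrite (expand_det_row _ ord0) !big_ord_recl big_ord0 /cofactor.
rewrite !(@expand_det_row _ 2 _ ord0) !big_ord_recl !big_ord0 /cofactor.
rewrite !det_mx11 !mxE !(tnth_nth i) /= /bump /=; ring.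
Qed.

End SmallDeterminants.

(** * Determinants of positive semidefinite matrices *)

Section PSD.
Variable C : numClosedFieldType.

(** In A = P^-1 * diag * P with P unitary, an eigenvalue is the value of the
    quadratic form of A at a column of P^-1. *)
Lemma det_psd_ge0 (n : nat) (A : 'M[C]_n) :
  A \is hermsymmx -> (forall x : 'cV_n, 0 <= (x ^t* *m A *m x) 0 0) ->
  0 <= \det A.
Proof.
move=> /hermitian_normalmx/orthomx_spectralP A_eq psdA.
pose P := spectralmx A; pose d := spectral_diag A.
have Punit : P \in unitmx by apply: spectral_unit.
have invP : invmx P = P ^t* by rewrite invmx_unitary ?spectral_unitarymx.
have dE : P *m A *m invmx P = diag_mx d.
  by rewrite A_eq !mulmxA mulmxV // mul1mx mulmxK.
rewrite A_eq !det_mulmx mulrAC -det_mulmx mulVmx // det1 mul1r det_diag.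
apply: prodr_ge0 => i _.
have := psdA (col i (invmx P)); congr (0 <= _).
have -> : (col i (invmx P)) ^t* = row i P.
  by rewrite invP; apply/matrixP=> a b; rewrite !mxE conjCK.
have -> : spectral_diag A 0 i = diag_mx d i i by rewrite mxE eqxx.
by rewrite -row_mul -dE [LHS]mxE [RHS]mxE; apply: eq_bigr => k _; rewrite !mxE.
Qed.

End PSD.

(** * From minors to phased blocks *)

Section Phased.
Variable R : realType.
Local Notation C := R[i]%C.

Definition phased_blocks (N : nat) (T : eqType) (lab : 'I_N -> T) (c : pred T)
    (u : 'I_N -> C) : 'M[C]_N :=
  \matrix_(i, j) (u i * (u j)^* *+ (c (lab i) && (lab i == lab j))).

Lemma hermsymm_entry (N : nat) (A : 'M[C]_N) (i j : 'I_N) :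
  A \is hermsymmx -> A j i = (A i j)^*.
Proof.
by move/is_hermitianmxP => eqA; rewrite [in LHS]eqA expr0 scale1r !mxE.
Qed.

(** The 3 x 3 minor is - |A i k - A i j * A j k| ^ 2 here, so it is nonnegative
    only if it vanishes. *)
Lemma kPMP_entry_mul (N : nat) (A : 'M[C]_N) (i j k : 'I_N) :
  kPMP 3 A -> uniq [:: i; j; k] -> A i i = 1 -> A j j = 1 -> A k k = 1 ->
  `|A i j| = 1 -> `|A j k| = 1 -> A i k = A i j * A j k.
Proof.
move=> A3 ijk_uniq Aii Ajj Akk nij njk.
have herm a b := hermsymm_entry a b A3.1.
have := @kPMP_det_mxsub _ _ _ _ A (tnth [tuple i; j; k]) A3 _ isT.
rewrite det_mxsub3 Aii Ajj Akk (herm i j) (herm j k) (herm i k).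
move=> /(_ (elimT (tuple_uniqP _) ijk_uniq)).
have eij : A i j * (A i j)^* = 1 by rewrite -normCK nij expr1n.
have ejk : A j k * (A j k)^* = 1 by rewrite -normCK njk expr1n.
set D := (X in 0 <= X).
have -> : D = - `|A i k - A i j * A j k| ^+ 2.
  rewrite normCK rmorphB rmorphM /=.
  rewrite {}/D; ring: eij ejk.
rewrite oppr_ge0 => le0; apply/eqP; rewrite -subr_eq0 -normr_eq0 -sqrf_eq0.
by rewrite eq_le le0 exprn_ge0.
Qed.

(** If A i i were 0, the minor on {i, j} would be - |A i j| ^ 2 < 0. *)
Lemma kPMP_diag_eq1 (N : nat) (A : 'M[C]_N) (i j : 'I_N) :
  kPMP 3 A -> entries_modulus01 A -> A i j != 0 -> A i i = 1.
Proof.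
move=> A3 A01 Aij.
have Aii_ge0 : 0 <= A i i.
  rewrite -det_mxsub1; apply: (kPMP_det_mxsub A3) => //.
  by move=> a b _; rewrite !ord1.
have := A01 i i; rewrite ger0_norm // => -[Aii0|//].
have [eij|ij] := eqVneq i j; first by rewrite -eij Aii0 eqxx in Aij.
have := @kPMP_det_mxsub _ _ _ _ A (tnth [tuple i; j]) A3 _ isT.
rewrite det_mxsub2 Aii0 mul0r sub0r (hermsymm_entry i j A3.1) -normCK.
have t_uniq : uniq [tuple i; j] by rewrite /= inE ij.
move=> /(_ (elimT (tuple_uniqP _) t_uniq)).
by rewrite oppr_ge0 real_leNgt ?rpredX ?normr_real // exprn_gt0 ?normr_gt0.
Qed.

(** Labels are canonical representatives of the classes of the relation: equal,
    or linked by a nonzero entry. An index with a zero row is alone in its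
    class, and its label is switched off. *)
Lemma kPMP_phased_blocks (N : nat) (A : 'M[C]_N) :
  kPMP 3 A -> entries_modulus01 A ->
  exists (lab : 'I_N -> 'I_N) (c : pred 'I_N) (u : 'I_N -> C),
    (forall i, `|u i| = 1) /\ A = phased_blocks lab c u.
Proof.
move=> A3 A01.
have herm a b := hermsymm_entry a b A3.1.
have nz_sym i j : (A j i != 0) = (A i j != 0) by rewrite herm conjC_eq0.
have diagl i j : A i j != 0 -> A i i = 1 by apply: kPMP_diag_eq1.
have diagr i j : A i j != 0 -> A j j = 1 by rewrite -nz_sym; apply: diagl.
have nrm i j : A i j != 0 -> `|A i j| = 1.
  by rewrite -normr_eq0; case: (A01 i j) => -> //; rewrite eqxx.
have mulA i j k : A i j != 0 -> A j k != 0 -> A i k = A i j * A j k.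
  move=> nij njk.
  have [<-|ij] := eqVneq i j; first by rewrite (diagl i j) ?mul1r.
  have [<-|jk] := eqVneq j k; first by rewrite (diagr i j) ?mulr1.
  have [<-|ik] := eqVneq i k.
    by rewrite (herm i j) -normCK nrm // expr1n (diagl i j).
  apply: kPMP_entry_mul => //; try by [apply: nrm]; last 3 first.
  - exact: diagl nij.
  - exact: diagr nij.
  - exact: diagr njk.
  by rewrite /= !inE negb_or ij ik jk.
pose e i j := (i == j) || (A i j != 0).
have exx i : e i i by rewrite /e eqxx.
have esym i j : e i j = e j i by rewrite /e eq_sym nz_sym.
have etrans : transitive e.
  move=> j i k /predU1P[<- // | nij] /predU1P[<- // | njk]; rewrite /e ?nij ?orbT //.
  by rewrite (mulA i j k) // mulf_neq0 ?orbT.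
have eq_e i j : e i j -> e i =1 e j.
  by move=> eij k; apply/idP/idP; apply: etrans; rewrite // esym.
pose lab i := odflt i [pick j | e i j].
have e_lab i : e i (lab i).
  by rewrite /lab; case: pickP => //= /(_ i); rewrite exx.
have labE i j : (lab i == lab j) = e i j.
  apply/eqP/idP => [eq_ij | eij].
    by apply: etrans (e_lab i) _; rewrite eq_ij esym.
  rewrite /lab (eq_pick (eq_e _ _ eij)).
  by case: pickP => //= /(_ j); rewrite exx.
(* The phase of i is its entry against the representative of its class; on a
   zero row the phase is arbitrary, since its label is switched off. *)
exists lab, (fun t => A t t != 0).
exists (fun i => if A i (lab i) == 0 then 1 else A i (lab i)).
split=> [i | ]; first by case: eqVneq => [_|/nrm //]; rewrite normr1.
apply/matrixP => i j; rewrite mxE labE.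
have [nij | Aij0] := eqVneq (A i j) 0; last first.
  have eij : lab i = lab j by apply/eqP; rewrite labE /e Aij0 orbT.
  have nil : A i (lab i) != 0.
    by case/predU1P: (e_lab i) => // <-; rewrite (diagl i j) ?oner_eq0.
  have njl : A j (lab j) != 0.
    by case/predU1P: (e_lab j) => // <-; rewrite (diagr i j) ?oner_eq0.
  rewrite (negbTE nil) (negbTE njl) (diagr _ _ nil) oner_eq0 /e Aij0 orbT /=.
  by rewrite -herm -eij -mulA // nz_sym eij.
have [eij | //] := boolP (e i j); last by rewrite andbF.
have Aii : A i i = 0.
  by move: eij; rewrite /e nij eqxx orbF => /eqP eij; rewrite [X in A _ X]eij.
suff -> : A (lab i) (lab i) = 0 by rewrite eqxx.
by case/predU1P: (e_lab i) => [<- // | /diagl/eqP]; rewrite Aii eq_sym oner_eq0.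
Qed.

(** * Block diagonal matrices and labels *)

Lemma mxdiag_const (m : nat) (p : 'I_m -> nat) (x : 'I_m -> C)
    (r s : 'I_(\sum_(i < m) p i)) :
  (\mxdiag_(i < m) (const_mx (x i) : 'M_(p i))) r s =
    x (tagnat.sig1 r) *+ (tagnat.sig1 r == tagnat.sig1 s).
Proof.
rewrite mxE; case: eqP => [eq_rs | _]; last by rewrite mxE.
by move: (tagnat.sig2 s); case: _ / eq_rs => b; rewrite conform_mx_id mxE.
Qed.

Lemma block_diag_phased_blocks (N : nat) (B : 'M[C]_N) :
  block_diag_ones_zeros B ->
  exists (T : finType) (lab : 'I_N -> T) (c : pred T),
    B = phased_blocks lab c (fun=> 1).
Proof.
move=> [m [p [eN [blk [_ blk01 ->]]]]].
exists 'I_m, (fun i => tagnat.sig1 (cast_ord (esym eN) i)).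
exists (fun a => blk a == const_mx 1).
have blkE a : blk a = const_mx (blk a == const_mx 1)%:R.
  by case: eqP => [-> // | n1]; case: (blk01 a).
apply/matrixP => i j; rewrite castmxE (eq_mxdiag blkE) mxdiag_const !mxE.
by rewrite conjC1 mulr1 -mulrnA mulnb.
Qed.

(** The blocks are the nonempty fibres of [lab]; concatenating enumerations of
    these fibres lists every index exactly once, which is the permutation. *)
Lemma block_diag_of_labels (N : nat) (T : finType) (lab : 'I_N -> T) (c : pred T) :
  exists s : 'S_N,
    block_diag_ones_zeros (phased_blocks (lab \o s) c (fun=> 1)).
Proof.
pose I := lab @: [set: 'I_N]; pose t (a : 'I_#|I|) : T := enum_val a.
pose cls a := [set x | lab x == t a]; pose p a := #|cls a|.
have eN : (\sum_(a < #|I|) p a)%N = N.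
  rewrite -[RHS]card_ord -cardsT -[RHS]sum1_card (partition_big_imset lab) /=.
  rewrite -/I [RHS]big_enum_val; apply: eq_bigr => a _.
  by rewrite /p -sum1_card; apply: eq_bigl => x; rewrite !inE.
pose f (r : 'I_(\sum_(a < #|I|) p a)) : 'I_N := enum_val (tagnat.sig2 r).
have lab_val a (x : 'I_(p a)) : lab (enum_val x) = t a.
  by have := enum_valP x; rewrite inE => /eqP.
have f_inj : injective f.
  have inj a b (x : 'I_(p a)) (y : 'I_(p b)) :
      enum_val x = enum_val y -> @tagnat.Rank _ p a x = @tagnat.Rank _ p b y.
    move=> xy; have ab : a = b.
      by apply: enum_val_inj; rewrite -[LHS](lab_val a x) -[RHS](lab_val b y) xy.
    by case: _ / ab y xy => y /enum_val_inj ->.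
  by move=> r r' /inj; rewrite !tagnat.sig2K.
have s_inj : injective (f \o cast_ord (esym eN)).
  exact: inj_comp f_inj (@cast_ord_inj _ _ _).
exists (perm s_inj), #|I|, p, eN, (fun a => const_mx (c (t a))%:R).
split=> [a | a | ].
- have /imsetP[x _ ax] : t a \in I by apply: enum_valP.
  by apply/card_gt0P; exists x; rewrite inE ax.
- by case: (c (t a)); [left | right].
apply/matrixP => i j; rewrite castmxE mxdiag_const !mxE /= !permE /= /f !lab_val.
by rewrite conjC1 mulr1 -mulrnA mulnb (inj_eq enum_val_inj).
Qed.

(** The permutation matrix is taken at the inverse of [s] so that the new
    position [i] receives the old index [s i]. *)
Lemma conj_perm_diag (N : nat) (A : 'M[C]_N) (s : 'S_N) (d : 'rV[C]_N)
    (M := perm_mx s^-1 *m diag_mx d) :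
  (forall i, `|d 0 i| = 1) ->
  invmx M *m A *m M = \matrix_(i, j) ((d 0 i)^* * A (s i) (s j) * d 0 j).
Proof.
move=> d1; pose M' := diag_mx (map_mx Num.conj d) *m perm_mx s.
have M'M : M' *m M = 1%:M.
  rewrite /M' /M mulmxA -(mulmxA _ (perm_mx s)) -perm_mxM mulgV perm_mx1 mulmx1.
  rewrite mulmx_diag; apply/matrixP => i j; by rewrite !mxE -normCKC d1 expr1n.
have [_ M_unit] := mulmx1_unit M'M.
have -> : invmx M = M' by rewrite -[invmx M]mul1mx -M'M mulmxK.
rewrite /M' /M !mulmxA -(mulmxA _ (perm_mx s) A) -(mulmxA _ _ (perm_mx s^-1)).
rewrite -row_permE -col_permE mul_diag_mx mul_mx_diag.
by apply/matrixP => i j; rewrite !mxE.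
Qed.

(** * Positive semidefiniteness and principal minors *)

(** A = sum of v v^* over the labels switched on, and each term contributes
    |x^* v| ^ 2 to the quadratic form. *)
Lemma phased_blocks_psd (N : nat) (T : finType) (lab : 'I_N -> T) (c : pred T)
    (u : 'I_N -> C) (x : 'cV[C]_N) :
  0 <= (x ^t* *m phased_blocks lab c u *m x) 0 0.
Proof.
pose v t : 'cV[C]_N := \col_i (u i *+ (lab i == t)).
have -> : phased_blocks lab c u = \sum_(t | c t) v t *m (v t) ^t*.
  apply/matrixP => i j; rewrite summxE mxE big_mkcond (bigD1 (lab i)) //=.
  rewrite big1 ?addr0 => [|t ti].
    case: (c _) => //=; rewrite !mxE big_ord_recl big_ord0 addr0 !mxE eqxx eq_sym.
    by case: eqP => _; rewrite ?mulr0n ?conjC0 ?mulr0.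
  case: ifP => // _; rewrite !mxE big_ord_recl big_ord0 addr0 !mxE.
  by rewrite eq_sym (negbTE ti) mul0r.
rewrite mulmx_sumr mulmx_suml summxE; apply: sumr_ge0 => t _.
rewrite mulmxA -mulmxA.
have -> : (v t) ^t* *m x = (x ^t* *m v t) ^t*.
  by rewrite trmx_mul map_mxM /= trmxCK.
by rewrite mxE big_ord_recl big_ord0 addr0 !mxE mul_conjC_ge0.
Qed.

(** The submatrix is F^* A F with F a selection of columns of the identity, so
    its quadratic form at x is that of A at F x. *)
Lemma psd_kPMP (k N : nat) (A : 'M[C]_N) :
  positive_semidefinite A -> kPMP k A.
Proof.
move=> [hA psdA]; split=> // S _; rewrite /principal_minor /principal_submx.
set f := enum_val; apply: det_psd_ge0 => [|x].
  apply/is_hermitianmxP; rewrite expr0 scale1r; apply/matrixP => i j.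
  by rewrite !mxE; apply: hermsymm_entry.
pose F : 'M[C]_(N, #|S|) := colsub f 1%:M.
have -> : mxsub f f A = F ^t* *m A *m F.
  have -> : F ^t* = rowsub f 1%:M.
    by apply/matrixP => i j; rewrite !mxE conjC_nat eq_sym.
  by rewrite -rowsubE mulmx_colsub mulmx1; apply/matrixP => i j; rewrite !mxE.
have := psdA (F *m x); rewrite trmx_mul map_mxM /= !mulmxA; exact.
Qed.

End Phased.

(** * The three equivalent conditions *)

Local Open Scope complex_scope.

Theorem theorem2p7 (R : realType) (N : nat) (hN : (1 <= N)%N)
    (A : 'M[R[i]]_N) (hA : A \is hermsymmx) :
  [<-> kPMP 3 A /\ entries_modulus01 A;
       exists D Q : 'M[R[i]]_N,
         [/\ unimodular_diag D, is_perm_mx Q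
           & block_diag_ones_zeros (invmx (Q *m D) *m A *m (Q *m D))];
       positive_semidefinite A /\ entries_modulus01 A].
Proof.
tfae.
- move=> [A3 A01]; have [lab [c [u [u1 ->]]]] := kPMP_phased_blocks A3 A01.
  have [s s_block] := block_diag_of_labels R lab c.
  pose d : 'rV[R[i]]_N := \row_i u (s i).
  exists (diag_mx d), (perm_mx s^-1); split; first split.
  + exact: diag_mx_is_diag.
  + by move=> i; rewrite !mxE eqxx u1.
  + exact: perm_mx_is_perm.
  rewrite conj_perm_diag => [|i]; last by rewrite mxE u1.
  congr block_diag_ones_zeros: s_block; apply/matrixP => i j; rewrite !mxE /=.
  rewrite conjC1 mulr1 mulrnAr mulrnAl mulrA -normCKC u1 expr1n mul1r.
  by rewrite -normCKC u1 expr1n.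
- move=> [D [Q [[/diag_mxP[d ->] d1] /is_perm_mxP[q ->]]]].
  have {}d1 i : `|d 0 i| = 1 by have := d1 i; rewrite mxE eqxx.
  rewrite -[q]invgK; set s := q^-1%g.
  rewrite conj_perm_diag // => /block_diag_phased_blocks[T [lab [c eqB]]].
  pose u i := d 0 (s^-1%g i).
  have u1 i : `|u i| = 1 by apply: d1.
  suff: A = phased_blocks (lab \o s^-1%g) c u.
    move=> eqA; split; first by split=> // x; rewrite eqA; apply: phased_blocks_psd.
    rewrite eqA.
    move=> i j; rewrite mxE; case: (_ && _); last by left; rewrite normr0.
    by right; rewrite normrM norm_conjC !u1 mulr1.
  apply/matrixP => i j; move/matrixP/(_ (s^-1%g i) (s^-1%g j)): eqB.
  rewrite !mxE !permKV conjC1 mulr1 -/(u i) -/(u j) => eqij.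
  rewrite /= -mulr_natr -eqij.
  transitivity ((u i * (u i)^*) * (u j * (u j)^*) * A i j); last by ring.
  by rewrite -!normCK !u1 expr1n !mul1r.
by move=> [psdA A01]; split=> //; apply: psd_kPMP.
Qed.
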